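(* Let $\mathcal{Q}^{\mathcal{S}}$ be the set of MLE-sufficient prescriptive solutions and let $u$ be a localization. If the search for prescriptive solutions is restricted to $\mathcal{Q}^{\mathcal{S}}$, then the problem $$\inf_{q(\cdot)\in\mathcal{Q}^{\mathcal{S}}} \Psi[q(\cdot);u]$$ reduces to (i.e. is the same optimization problem, with the same objective function on $\mathcal{Q}^{\mathcal{S}}$, as) $$\inf_{q(\cdot)\in\mathcal{Q}^{\mathcal{S}}} \int_{\Theta} K(\hat\theta)\,\beth(q(\hat\theta),\hat\theta)\,d\hat\theta,$$ where $$K(\hat\theta) := \int_{\{\boldsymbol y:\hat\theta(\boldsymbol y)=\hat\theta\}} g_0(\hat\theta,\boldsymbol y|\hat\theta)\,J(\hat\theta,\boldsymbol y|\hat\theta)\,d(\boldsymbol y|\hat\theta), \qquad \beth(q,\hat\theta) := \int_{\Theta}\phi(q;\theta)\,g_1(\hat\theta,\theta)\,u(\theta)\,d\theta .$$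
   Context: Setting. $\mathcal{Q}\subseteq\mathbb{R}$ is the feasible set of decisions $q$. The uncertain variable $d$ takes values in an outcome space $\mathcal{D}$ (with reference measure written $dd$), and $C(q,d)$ is a real-valued cost function. The hypothesis set is a family of probability densities $\{f(\cdot;\theta):\theta\in\Theta\}$ on $\mathcal{D}$ with $\Theta\subseteq\mathbb{R}^o$. The expected cost is $\phi(q;\theta):=\int_{\mathcal{D}}C(q,d)f(d;\theta)\,dd$. Data. A data set of size $N$ is $\boldsymbol y=(y_1,\dots,y_N)\in\mathcal{Y}:=\mathcal{D}^N$, consisting of i.i.d. samples from $f(\cdot;\theta)$, with joint density $g(\boldsymbol y;\theta):=\prod_{n=1}^N f(y_n;\theta)$. A prescriptive solution is a function $\boldsymbol y\mapsto q(\boldsymbol y)$ from $\mathcal{Y}$ to $\mathbb{R}$, feasible in the sense that $q(\boldsymbol y)\in\mathcal{Q}$, with no explicit dependence on $\theta$. Localization and performance. A localization $u$ is a probability density on $\Theta$. The expected out-of-sample performance of $q(\cdot)$ with respect to $u$ is $$\Psi[q(\cdot);u]:=\int_\Theta\int_{\mathcal{Y}}\int_{\mathcal{D}}C(q(\boldsymbol y),d)\,f(d;\theta)\,g(\boldsymbol y;\theta)\,u(\theta)\,dd\,d\boldsymbol y\,d\theta .$$ Sufficient statistic. $\hat\theta:\mathcal{Y}\to\Theta$ is the maximum likelihood estimator, $\hat\theta(\boldsymbol y)$ maximizing $g(\boldsymbol y;\theta)$ over $\theta\in\Theta$. It is assumed to be a sufficient statistic, so there are non-negative functions $g_0,g_1$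 with $g(\boldsymbol y;\theta)=g_0(\boldsymbol y)\,g_1(\hat\theta(\boldsymbol y),\theta)$ for all $\boldsymbol y\in\mathcal{Y}$, $\theta\in\Theta$. A prescriptive solution is MLE-sufficient if it depends on $\boldsymbol y$ only through $\hat\theta(\boldsymbol y)$, i.e. it can be written $q(\hat\theta(\boldsymbol y))$ (also denoted $q(\hat\theta)$); $\mathcal{Q}^{\mathcal{S}}$ is the class of these. Change of variables (assumption). There is a re-parametrization of $\boldsymbol y\in\mathcal{Y}$ as $(\hat\theta,\boldsymbol y|\hat\theta)\in\Theta\times\mathcal{D}^{N-o}$, where $\boldsymbol y|\hat\theta$ denotes some parametrization of the fibre $\{\boldsymbol y:\hat\theta(\boldsymbol y)=\hat\theta\}$ for given $\hat\theta$, and the Jacobian $J(\hat\theta,\boldsymbol y|\hat\theta)$ of this change of variables exists and is non-negative everywhere. Thus $$\int_{\mathcal{Y}}h(\boldsymbol y)\,d\boldsymbol y=\int_\Theta\int_{\{\boldsymbol y:\hat\theta(\boldsymbol y)=\hat\theta\}}h(\hat\theta,\boldsymbol y|\hat\theta)\,J(\hat\theta,\boldsymbol y|\hat\theta)\,d(\boldsymbol y|\hat\theta)\,d\hat\theta,$$ where $h(\hat\theta,\boldsymbol y|\hat\theta)$ denotes $h$ in the new coordinates; $g_0(\hat\theta,\boldsymbol y|\hat\theta)$ is understood likewise. Convention. All functions are measurable, and the integrals written are assumed to be well defined with interchange of the order of integration permitted. *)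

(* Defs.v *)
From HB Require Import structures.
From mathcomp Require Import all_boot all_order all_algebra.
From mathcomp Require Import all_classical all_reals all_analysis.
From mathcomp Require Import measurable_realfun.

Set Implicit Arguments.
Unset Strict Implicit.
Unset Printing Implicit Defensive.

Import Order.TTheory GRing.Theory Num.Theory.
Import numFieldNormedType.Exports.

Local Open Scope classical_set_scope.
Local Open Scope ring_scope.
Local Open Scope ereal_scope.

(* The library's sigma-finiteness instance for m1 \x m2 is not found by
   inference, being shadowed by a later instance on subprobabilities. *)
Lemma product_sigma_finite {R : realType} {d1 d2 : measure_display}
    {T1 : measurableType d1} {T2 : measurableType d2}
    (m1 : {sigma_finite_measure set T1 -> \bar R})
    (m2 : {sigma_finite_measure set T2 -> \bar R}) :
  sigma_finite setT (m1 \x m2).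
Proof.
have /sigma_finiteP[F [TF ndF Foo]] := sigma_finiteT m1.
have /sigma_finiteP[G [TG ndG Goo]] := sigma_finiteT m2.
exists (fun n => F n `*` G n).
  rewrite -setXTT TF TG; apply/seteqP; split=> -[x y] /=.
    move=> [[n _ Fnx] [k _ Gky]]; exists (maxn n k) => //; split.
    - by move: x Fnx; exact/subsetPset/ndF/leq_maxl.
    - by move: y Gky; exact/subsetPset/ndG/leq_maxr.
  by move=> [n _ [Fx Gy]]; split; exists n.
move=> k; have [? ?] := Foo k; have [? ?] := Goo k.
split; first exact: measurableX.
by rewrite product_measure1E// lte_mul_pinfty// ge0_fin_numE.
Qed.

Section PowerMeasure.
Context {R : realType} {d : measure_display} {T : measurableType d}.

Definition tcons (n : nat) (p : T * n.-tuple T) : n.+1.-tuple T :=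
  [tuple of p.1 :: p.2].

Lemma measurable_tcons (n : nat) : measurable_fun setT (@tcons n).
Proof. exact: measurable_cons. Qed.

HB.instance Definition _ (n : nat) :=
  isMeasurableFun.Build _ _ _ _ (@tcons n) (@measurable_tcons n).

Definition power_step (mu : {sigma_finite_measure set T -> \bar R}) (n : nat)
    (m : {sigma_finite_measure set n.-tuple T -> \bar R}) :
    set (n.+1.-tuple T) -> \bar R :=
  pushforward (mu \x m) (@tcons n).

Section Step.
Variables (mu : {sigma_finite_measure set T -> \bar R}) (n : nat).
Variable m : {sigma_finite_measure set n.-tuple T -> \bar R}.

Let power_step0 : power_step mu m set0 = 0.
Proof. exact: measure0. Qed.

Let power_step_ge0 A : 0 <= power_step mu m A.
Proof. exact: measure_ge0. Qed.

Let power_step_sigma_additive : semi_sigma_additive (power_step mu m).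
Proof. exact: measure_semi_sigma_additive. Qed.

HB.instance Definition _ := isMeasure.Build _ _ _ (power_step mu m)
  power_step0 power_step_ge0 power_step_sigma_additive.

Let power_step_sigma_finite : sigma_finite setT (power_step mu m).
Proof.
have [F UF mF] : sigma_finite setT (mu \x m) by exact: product_sigma_finite.
pose g (t : n.+1.-tuple T) := (thead t, [tuple of behead t]).
have Kg : cancel (@tcons n) g.
  by case=> x t; rewrite /g theadE; congr pair; exact/val_inj.
have mg : measurable_fun setT g.
  apply: measurable_fun_pair; last exact: measurable_behead.
  exact: measurable_tnth.
exists (fun i => g @^-1` F i).
  by rewrite -preimage_bigcup -UF preimage_setT.
move=> i; have [mFi Fioo] := mF i; split.
  by rewrite -[X in measurable X]setTI; exact: mg.
rewrite /power_step /pushforward -comp_preimage.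
by rewrite (_ : g \o _ = id) ?preimage_id//; exact/funext.
Qed.

HB.instance Definition _ := Measure_isSigmaFinite.Build _ _ _
  (power_step mu m) power_step_sigma_finite.
End Step.

Fixpoint power_measure (mu : {sigma_finite_measure set T -> \bar R}) (n : nat) :
    {sigma_finite_measure set n.-tuple T -> \bar R} :=
  match n with
  | 0 => dirac [tuple]
  | n'.+1 => power_step mu (power_measure mu n')
  end.

Lemma power_measure_box (mu : {sigma_finite_measure set T -> \bar R}) (n : nat)
    (A : 'I_n -> set T) : (forall i, measurable (A i)) ->
  power_measure mu n [set t | forall i, A i (tnth t i)] = \prod_(i < n) mu (A i).
Proof.
elim: n A => [|n IH] A mA.
  rewrite big_ord0 /= diracE mem_set//= => -[]//.
rewrite big_ord_recl /= /power_step /pushforward.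
rewrite (_ : _ @^-1` _ = A ord0 `*`
   [set t : n.-tuple T | forall i, A (lift ord0 i) (tnth t i)]); last first.
  apply/seteqP; split=> [[x t]|[x t] [/= Ax At] i] /=.
    move=> H; split=> /=; first exact: (H ord0).
    by move=> i; have := H (lift ord0 i); rewrite tnthS.
  by case: (unliftP ord0 i) => [j ->|->]//; rewrite tnthS.
rewrite product_measure1E//; last first.
  rewrite (_ : [set _ | _] = \bigcap_(i in [set: 'I_n]) ((fun t => tnth t i) @^-1` A (lift ord0 i))).
    apply: fin_bigcap_measurable => // i _.
    by rewrite -[X in measurable X]setTI; exact: measurable_tnth.
  by apply/seteqP; split=> [t H i _|t H i]; exact: H.
congr (_ * _).
by rewrite -(IH (fun i => A (lift ord0 i))).
Qed.
End PowerMeasure.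

Notation euclidean R o := (o.-tuple (measurableTypeR R)).

Definition lebesgue_euclidean {R : realType} (o : nat) :
    {sigma_finite_measure set (euclidean R o) -> \bar R} :=
  power_measure (@lebesgue_measure R) o.

Definition is_density {R : realType} {d : measure_display}
    {T : measurableType d} (m : set T -> \bar R) (A : set T) (p : T -> R) : Prop :=
  [/\ measurable_fun A p, (forall x, A x -> (0 <= p x)%R)
    & \int[m]_(x in A) (p x)%:E = 1].

(* The integral exists as an element of [-oo, +oo]: it is not +oo - oo.
   For jointly measurable functions and sigma-finite measures, this is what
   allows iterated integrals to be interchanged. *)
Definition integral_well_defined {R : realType} {d : measure_display}
    {T : measurableType d} (m : set T -> \bar R) (A : set T)
    (h : T -> \bar R) : Prop :=
  \int[m]_(x in A) h^\+ x < +oo \/ \int[m]_(x in A) h^\- x < +oo.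

Section Model.
Context {R : realType} {d : measure_display} {D : measurableType d}.
Context {N o : nat}.
Variable mu : {sigma_finite_measure set D -> \bar R}.
Variables (C : R -> D -> R) (f : D -> euclidean R o -> R).
Variables (Q : set R) (Theta : set (euclidean R o)).
Variable u : euclidean R o -> R.

Definition expected_cost (q : R) (theta : euclidean R o) : \bar R :=
  \int[mu]_x (C q x * f x theta)%:E.

Definition joint_density (y : N.-tuple D) (theta : euclidean R o) : R :=
  (\prod_(n < N) f (tnth y n) theta)%R.

Definition performance_integrand (q : N.-tuple D -> R)
    (theta : euclidean R o) (y : N.-tuple D) (x : D) : R :=
  (C (q y) x * f x theta * joint_density y theta * u theta)%R.

Definition performance (q : N.-tuple D -> R) : \bar R :=
  \int[lebesgue_euclidean o]_(theta in Theta) \int[power_measure mu N]_y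
    \int[mu]_x (performance_integrand q theta y x)%:E.

Definition performance_well_defined (q : N.-tuple D -> R) : Prop :=
  integral_well_defined
    ((lebesgue_euclidean o \x power_measure mu N) \x mu)
    ((Theta `*` [set: N.-tuple D]) `*` [set: D])
    (fun p => (performance_integrand q p.1.1 p.1.2 p.2)%:E).

Definition is_mle (hat : N.-tuple D -> euclidean R o) : Prop :=
  forall y, Theta (hat y) /\
    forall theta, Theta theta -> (joint_density y theta <= joint_density y (hat y))%R.

Definition sufficient_factorization (hat : N.-tuple D -> euclidean R o)
    (g0 : N.-tuple D -> R) (g1 : euclidean R o -> euclidean R o -> R) : Prop :=
  [/\ forall y, (0 <= g0 y)%R,
      forall t theta, Theta t -> Theta theta -> (0 <= g1 t theta)%R
    & forall y theta, Theta theta ->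
        joint_density y theta = (g0 y * g1 (hat y) theta)%R].

Definition prescriptive_solution : set (N.-tuple D -> R) :=
  [set q | measurable_fun setT q /\ forall y, Q (q y)].

(* Feasibility constrains qh only on the range of hat: elsewhere the fibre is
   empty and qh contributes to no objective. *)
Definition mle_rule (hat : N.-tuple D -> euclidean R o) :
    set (euclidean R o -> R) :=
  [set qh | measurable_fun Theta qh /\ prescriptive_solution (qh \o hat)].

Definition mle_sufficient (hat : N.-tuple D -> euclidean R o) :
    set (N.-tuple D -> R) :=
  [set qh \o hat | qh in mle_rule hat].

(* The fibre {y | hat y = t} is parametrized by chart (t, _) over the region
   xsection F t of D^(N - o).  As D carries no differential structure, J is
   the density through which the change of variables acts on integrals. *)
Record reparametrization (hat : N.-tuple D -> euclidean R o)
    (F : set (euclidean R o * (N - o).-tuple D))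
    (chart : euclidean R o * (N - o).-tuple D -> N.-tuple D)
    (J : euclidean R o * (N - o).-tuple D -> R) : Prop := {
  reparam_region : measurable F ;
  reparam_measurable : measurable_fun F chart ;
  reparam_bij : forall t, Theta t ->
    set_bij (xsection F t) [set y | hat y = t] (fun z => chart (t, z)) ;
  jacobian_measurable : measurable_fun F J ;
  jacobian_ge0 : forall p, F p -> (0 <= J p)%R ;
  change_of_variables : forall h : N.-tuple D -> \bar R,
    measurable_fun setT h -> (forall y, 0 <= h y) ->
    \int[power_measure mu N]_y h y =
    \int[lebesgue_euclidean o]_(t in Theta)
      \int[power_measure mu (N - o)]_(z in xsection F t)
        (h (chart (t, z)) * (J (t, z))%:E) }.

Definition fibre_weight (F : set (euclidean R o * (N - o).-tuple D))
    (chart : euclidean R o * (N - o).-tuple D -> N.-tuple D)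
    (J : euclidean R o * (N - o).-tuple D -> R) (g0 : N.-tuple D -> R)
    (t : euclidean R o) : \bar R :=
  \int[power_measure mu (N - o)]_(z in xsection F t)
    (g0 (chart (t, z)) * J (t, z))%:E.

Definition beth (g1 : euclidean R o -> euclidean R o -> R) (q : R)
    (t : euclidean R o) : \bar R :=
  \int[lebesgue_euclidean o]_(theta in Theta)
    (expected_cost q theta * (g1 t theta * u theta)%:E).

Definition reduced_objective (K : euclidean R o -> \bar R)
    (g1 : euclidean R o -> euclidean R o -> R) (qh : euclidean R o -> R) : \bar R :=
  \int[lebesgue_euclidean o]_(t in Theta) (K t * beth g1 (qh t) t).

End Model.

(* Main.v *)
(** With the factorization g(y; theta) = g0(y) g1(hat y, theta), the integrand of
    Psi[qh o hat; u], once integrated over the outcome, is psi(hat y, theta) g0(y)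
    with psi(t, theta) = phi(qh t; theta) g1(t, theta) u(theta).  Tonelli's theorem
    and the change of variables, applied separately to the positive and negative
    parts of psi, turn the double integral into that of K times the integral of
    psi^+ (resp. psi^-) over theta.  Well-definedness makes one of the two results
    finite, so they can be subtracted; writing P+ and P- for the integrals of psi^+
    and psi^- over theta, K P+ or K P- is finite almost everywhere, and there
    K (P+ - P-) = K P+ - K P-, even when K = 0 and P+ = P- = oo. *)

Require Import Defs.
From HB Require Import structures.
From mathcomp Require Import all_boot all_order all_algebra.
From mathcomp Require Import all_classical all_reals all_analysis.
From mathcomp Require Import measurable_realfun.
Import Order.TTheory GRing.Theory Num.Theory.
Import numFieldNormedType.Exports.
Local Open Scope classical_set_scope.
Local Open Scope ring_scope.
Local Open Scope ereal_scope.

(** * Differences and products of extended reals that may be infinite *)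

Section parts.
Context {R : realType}.
Implicit Types a b : \bar R.

Lemma maxeB0_le a b : 0 <= a -> 0 <= b -> maxe (a - b) 0 <= a.
Proof.
by move=> a0 b0; rewrite ge_max a0 andbT geeDl// leeNl oppe0.
Qed.

(* This covers [a = b = +oo], where [a - b] is [-oo] by convention. *)
Lemma maxeNB0_le a b : 0 <= a -> 0 <= b -> maxe (- (a - b)) 0 <= b.
Proof.
move=> a0 b0; rewrite ge_max b0 andbT.
move: a b a0 b0 => [a| |] [b| |]//=; rewrite ?leey ?leNye// !lee_fin => a0 b0.
by rewrite opprB gerBl.
Qed.

(** A subtraction-free form of c = c^+ - c^- for c = a - b: being an equality of sums of
    non-negative terms, it can be integrated term by term. *)
Lemma maxeB0D a b : 0 <= a -> 0 <= b -> (a \is a fin_num) || (b \is a fin_num) ->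
  maxe (a - b) 0 + b = maxe (- (a - b)) 0 + a.
Proof.
move: a b => [a| |] [b| |]// _ _ _; last 2 first.
- by rewrite /= maxNye maxye.
- by rewrite /= maxNye maxye.
rewrite -EFinB -EFinN -!EFin_max -!EFinD opprB; congr EFin.
have [ab|/ltW ab] := leP a b.
  by rewrite max_r ?max_l ?subr_le0 ?subr_ge0// add0r subrK.
by rewrite max_l ?max_r ?subr_le0 ?subr_ge0// add0r subrK.
Qed.

(** For k = 0 both sides vanish, and for k > 0 multiplication fixes each infinity, so the
    conventional value of oo - oo is the same on both sides. *)
Lemma EFin_ge0_muleBr (k : R) a b : (0 <= k)%R ->
  k%:E * (a - b) = k%:E * a - k%:E * b.
Proof.
rewrite le_eqVlt => /predU1P[<-|k0]; first by rewrite !mul0e subee.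
case: a b => [a| |] [b| |];
  rewrite ?(gt0_muley, gt0_muleNy, mulry, mulrNy, gtr0_sg) ?lte_fin//= ?mul1e//.
by rewrite -EFinB -!EFinM mulrBr.
Qed.

(** The delicate case is k = +oo, where each product is 0 or +oo: finiteness of one of them forces a
    = 0 or b = 0, ruling out oo * (2 - 1) against oo - oo. *)
Lemma ge0_muleBr (k a b : \bar R) : 0 <= k -> 0 <= a -> 0 <= b ->
  (k * a \is a fin_num) || (k * b \is a fin_num) -> k * (a - b) = k * a - k * b.
Proof.
move: k => [k| |]//; first by move=> k0 _ _ _; rewrite EFin_ge0_muleBr.
move=> _; rewrite !le_eqVlt => /predU1P[<-|a0] /predU1P[<-|b0].
- by rewrite !(mule0, sube0).
- by rewrite mule0 !sub0e muleN.
- by rewrite mule0 !sube0.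
- by rewrite (gt0_mulye a0) (gt0_mulye b0).
Qed.

End parts.

(** * Subtraction of integrals when only one of them is finite *)

Section integration.
Context d (T : measurableType d) (R : realType) (m : {measure set T -> \bar R}).

Lemma ge0_ae_fin_num (D : set T) (a : T -> \bar R) : measurable D ->
  measurable_fun D a -> (forall x, D x -> 0 <= a x) ->
  \int[m]_(x in D) a x < +oo ->
  {ae m, forall x, D x -> a x \is a fin_num}.
Proof.
move=> mD ma a0 aoo; apply: integrable_ae => //.
apply/integrableP; split=> //.
by under eq_integral => x /set_mem Dx do rewrite gee0_abs ?a0//.
Qed.

Lemma ge0_integralB (D : set T) (a b : T -> \bar R) : measurable D ->
  measurable_fun D a -> measurable_fun D b ->
  (forall x, D x -> 0 <= a x) -> (forall x, D x -> 0 <= b x) ->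
  \int[m]_(x in D) a x < +oo \/ \int[m]_(x in D) b x < +oo ->
  \int[m]_(x in D) (a x - b x) = \int[m]_(x in D) a x - \int[m]_(x in D) b x.
Proof.
move=> mD ma mb a0 b0 aboo.
pose c := a \- b.
have mc : measurable_fun D c by exact: emeasurable_funB.
have mcp : measurable_fun D c^\+ by exact: measurable_funepos.
have mcn : measurable_fun D c^\- by exact: measurable_funeneg.
have cpa x : D x -> c^\+ x <= a x.
  by move=> Dx; rewrite funeposE maxeB0_le ?a0 ?b0.
have cnb x : D x -> c^\- x <= b x.
  by move=> Dx; rewrite funenegE maxeNB0_le ?a0 ?b0.
have abfin : {ae m, forall x, D x -> (a x \is a fin_num) || (b x \is a fin_num)}.
  by case: aboo => oo; [have := ge0_ae_fin_num _ _ mD ma a0 oo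
    | have := ge0_ae_fin_num _ _ mD mb b0 oo];
    apply: filterS => x + Dx => /(_ Dx) ->; rewrite ?orbT.
have E : \int[m]_(x in D) (c^\+ x + b x) = \int[m]_(x in D) (c^\- x + a x).
  apply: ge0_ae_eq_integral => //.
  - exact: emeasurable_funD.
  - exact: emeasurable_funD.
  - by move=> x Dx; rewrite adde_ge0 ?b0.
  - by move=> x Dx; rewrite adde_ge0 ?a0.
  - apply: filterS abfin => x + Dx => /(_ Dx) fin.
    by rewrite /= funeposE funenegE maxeB0D ?a0 ?b0.
rewrite !ge0_integralD// in E.
have cpaI : \int[m]_(x in D) c^\+ x <= \int[m]_(x in D) a x.
  exact: ge0_le_integral.
have cnbI : \int[m]_(x in D) c^\- x <= \int[m]_(x in D) b x.
  exact: ge0_le_integral.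
rewrite [LHS]integralE -/c.
have : 0 <= \int[m]_(x in D) a x by exact: integral_ge0.
have : 0 <= \int[m]_(x in D) b x by exact: integral_ge0.
have : 0 <= \int[m]_(x in D) c^\+ x by exact: integral_ge0.
have : 0 <= \int[m]_(x in D) c^\- x by exact: integral_ge0.
move: E cpaI cnbI aboo.
move: (\int[m]_(x in D) c^\+ x) (\int[m]_(x in D) c^\- x)
  (\int[m]_(x in D) a x) (\int[m]_(x in D) b x).
(* A case with an infinite value either contradicts the hypotheses or gives the same infinity on
   both sides; what is left is real arithmetic. *)
move=> [X| |] [Y| |] [A| |] [B| |]//=; try solve [by case | by move=> _ _ _ []].
move=> [E] _ _ _ _ _ _ _; rewrite -!EFinB; congr EFin; apply/eqP.
by rewrite subr_eq addrAC eq_sym subr_eq addrC -E.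
Qed.

(** The integral is by definition the difference of those of [h^\+] and [h^\-], and a finite k >= 0
    distributes over any difference, oo - oo included. *)
Lemma ge0_integralZr_EFin (h : T -> \bar R) (k : R) : (0 <= k)%R ->
  measurable_fun setT h ->
  \int[m]_x (h x * k%:E) = (\int[m]_x h x) * k%:E.
Proof.
move=> k0 mh; under eq_integral do rewrite muleC.
rewrite integralE [in RHS]integralE muleC EFin_ge0_muleBr//.
rewrite ge0_funeposM// ge0_funenegM// !ge0_integralZl_EFin//.
- exact: measurable_funeneg.
- exact: measurable_funepos.
Qed.

(** With its negative counterpart below, this lets finiteness of one part of the full integrand
    survive integration over the outcome. *)
Lemma funepos_integral_le (h : T -> \bar R) :
  maxe (\int[m]_x h x) 0 <= \int[m]_x maxe (h x) 0.
Proof.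
have <- : \int[m]_x h^\+ x = \int[m]_x maxe (h x) 0.
  by apply: eq_integral => x _; rewrite funeposE.
by rewrite integralE maxeB0_le// integral_ge0.
Qed.

Lemma funeneg_integral_le (h : T -> \bar R) :
  maxe (- \int[m]_x h x) 0 <= \int[m]_x maxe (- h x) 0.
Proof.
have <- : \int[m]_x h^\- x = \int[m]_x maxe (- h x) 0.
  by apply: eq_integral => x _; rewrite funenegE.
by rewrite integralE maxeNB0_le// integral_ge0.
Qed.

End integration.

(** * Measurability and finiteness of iterated integrals *)

Lemma measurable_fun_integral_section d1 d2 (T1 : measurableType d1)
    (T2 : measurableType d2) (R : realType)
    (m2 : {sigma_finite_measure set T2 -> \bar R}) (h : T1 * T2 -> \bar R) :
  measurable_fun setT h -> measurable_fun setT (fun x => \int[m2]_y h (x, y)).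
Proof.
move=> mh.
rewrite (_ : (fun _ => _) =
    (fun x => \int[m2]_y h^\+ (x, y) - \int[m2]_y h^\- (x, y))); last first.
  apply/funext => x; rewrite integralE; congr (_ - _); apply: eq_integral => y _;
    by rewrite ?funeposE ?funenegE.
apply: emeasurable_funB; apply: measurable_fun_fubini_tonelli_F => //.
- exact: measurable_funepos.
- exact: measurable_funeneg.
Qed.

(** Tonelli and monotonicity. It converts well-definedness on the triple product into finiteness of
    an iterated integral over parameter and data. *)
Lemma ge0_iterated_integral_lty d1 d2 d3 (T1 : measurableType d1)
    (T2 : measurableType d2) (T3 : measurableType d3) (R : realType)
    (m1 : {sigma_finite_measure set T1 -> \bar R})
    (m2 : {sigma_finite_measure set T2 -> \bar R})
    (m3 : {sigma_finite_measure set T3 -> \bar R})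
    (a : T1 * T2 -> \bar R) (h : (T1 * T2) * T3 -> \bar R) :
  measurable_fun setT a -> (forall p, 0 <= a p) ->
  measurable_fun setT h -> (forall p, 0 <= h p) ->
  (forall p, a p <= \int[m3]_z h (p, z)) ->
  \int[(m1 \x m2) \x m3]_p h p < +oo ->
  \int[m1]_x \int[m2]_y a (x, y) < +oo.
Proof.
move=> ma a0 mh h0 ah.
(* Tonelli on the outer product needs [m1 \x m2] as a sigma-finite measure, hence the explicit
   packing. *)
pose m12 : {sigma_finite_measure set (T1 * T2)%type -> \bar R} :=
  HB.pack (m1 \x m2)
    (Measure_isSigmaFinite.Build _ _ _ _ (product_sigma_finite m1 m2)).
rewrite -[X in X < _ -> _]/(\int[m12 \x m3]_p h p) fubini_tonelli1//.
have -> : \int[m1]_x \int[m2]_y a (x, y) = \int[m12]_p a p.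
  by rewrite [RHS]fubini_tonelli1.
apply: le_lt_trans.
apply: ge0_le_integral => //; exact: measurable_fun_fubini_tonelli_F.
Qed.

(** * Integrating out the data along the fibres of the statistic *)

Section sufficient_reduction.
Context {R : realType} {dX dY dZ : measure_display} {X : measurableType dX}
  {Y : measurableType dY} {Z : measurableType dZ}.
Variables (l : {sigma_finite_measure set X -> \bar R})
  (n : {sigma_finite_measure set Y -> \bar R})
  (z : {sigma_finite_measure set Z -> \bar R}).
Variables (Theta : set X) (hat : Y -> X) (F : set (X * Z)%type) (chart : X * Z -> Y)
  (J : X * Z -> R) (g0 : Y -> R).
Hypothesis mTheta : measurable Theta.
Hypothesis mhat : measurable_fun setT hat.
Hypothesis mF : measurable F.
Hypothesis mchart : measurable_fun F chart.
Hypothesis mJ : measurable_fun F J.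
Hypothesis mg0 : measurable_fun setT g0.
Hypothesis J0 : forall p, F p -> (0 <= J p)%R.
Hypothesis g00 : forall y, (0 <= g0 y)%R.
Hypothesis hat_chart : forall t w, Theta t -> F (t, w) -> hat (chart (t, w)) = t.
Hypothesis cov : forall h : Y -> \bar R,
  measurable_fun setT h -> (forall y, 0 <= h y) ->
  \int[n]_y h y =
  \int[l]_(t in Theta) \int[z]_(w in xsection F t)
        (h (chart (t, w)) * (J (t, w))%:E).

Let K t := \int[z]_(w in xsection F t) (g0 (chart (t, w)) * J (t, w))%:E.

(** Extension by zero makes [K] an integral over all of [Z] of a jointly measurable function, so
    that Tonelli yields its measurability. *)
Let weight := (fun p => (g0 (chart p) * J p)%:E) \_ F.

Let KE t : K t = \int[z]_w weight (t, w).
Proof.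
rewrite /K integral_mkcond; apply: eq_integral => w _.
rewrite /weight !patchE; congr (if _ then _ else _).
by apply/idP/idP; rewrite !inE /xsection/= inE.
Qed.

Let weight_ge0 p : 0 <= weight p.
Proof. by apply: erestrict_ge0 => q Fq; rewrite lee_fin mulr_ge0// J0. Qed.

Let measurable_weight : measurable_fun setT weight.
Proof.
apply: (measurable_restrictT _ mF).1; apply/measurable_EFinP.
by apply: measurable_funM => //; exact: measurableT_comp.
Qed.

Let measurable_fibre_weight t :
  measurable_fun (xsection F t) (fun w => (g0 (chart (t, w)) * J (t, w))%:E).
Proof.
apply/measurable_EFinP; apply: measurable_funM.
  apply: measurableT_comp => //.
  apply: (measurable_comp mF _ mchart); last exact: measurableT_comp.
  by move=> _ [w + <-]; rewrite /xsection/= inE.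
apply: (measurable_comp mF _ mJ); last exact: measurableT_comp.
by move=> _ [w + <-]; rewrite /xsection/= inE.
Qed.

Let K_ge0 t : 0 <= K t.
Proof. by rewrite KE; exact: integral_ge0. Qed.

Let measurable_K : measurable_fun setT K.
Proof.
by rewrite (funext KE); exact: measurable_fun_fubini_tonelli_F.
Qed.

(** After Tonelli, the change of variables is applied to the function of y obtained by integrating
    out s. On the fibre over t the statistic equals t, so the integral of G (t, s) over s is
    constant there and factors out, leaving [K t]. *)
Lemma ge0_sufficient_reduction (G : X * X -> \bar R) :
  measurable_fun setT G -> (forall p, 0 <= G p) ->
  \int[l]_s \int[n]_y (G (hat y, s) * (g0 y)%:E) =
  \int[l]_(t in Theta) (K t * \int[l]_s G (t, s)).
Proof.
move=> mG G0.
have mH : measurable_fun setT (fun p : X * Y => G (hat p.2, p.1) * (g0 p.2)%:E).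
  apply: emeasurable_funM.
    apply: measurableT_comp => //; apply: measurable_fun_pair => //.
    exact: measurableT_comp.
  by apply: measurableT_comp => //; exact: measurableT_comp.
have H0 p : 0 <= G (hat p.2, p.1) * (g0 p.2)%:E.
  by rewrite mule_ge0 ?lee_fin ?G0 ?g00.
rewrite (fubini_tonelli (fun p : X * Y => G (hat p.2, p.1) * (g0 p.2)%:E))//=.
rewrite cov; last 2 first.
  exact: (measurable_fun_fubini_tonelli_G
    (fun p : X * Y => G (hat p.2, p.1) * (g0 p.2)%:E)).
  by move=> y; apply: integral_ge0 => s _; exact: (H0 (s, y)).
have mGt t : measurable_fun setT (fun s => G (t, s)).
  exact: measurableT_comp.
apply: eq_integral => t /set_mem Tt.
transitivity (\int[z]_(w in xsection F t)
   ((g0 (chart (t, w)) * J (t, w))%:E * \int[l]_s G (t, s))).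
  apply: eq_integral => w; rewrite inE /xsection/= inE => Ftw.
  rewrite hat_chart// ge0_integralZr_EFin//.
  by rewrite EFinM -muleA muleC.
rewrite ge0_integralZr//.
- exact: measurable_xsection.
- by move=> w; rewrite /xsection/= inE => Ftw; rewrite lee_fin mulr_ge0// J0.
- exact: integral_ge0.
Qed.

Lemma sufficient_reduction (psi : X * X -> \bar R)
    (H := fun s y => psi (hat y, s) * (g0 y)%:E) :
  measurable_fun setT psi ->
  \int[l]_s \int[n]_y maxe (H s y) 0 < +oo \/
  \int[l]_s \int[n]_y maxe (- H s y) 0 < +oo ->
  \int[l]_s \int[n]_y H s y =
  \int[l]_(t in Theta) (K t * \int[l]_s psi (t, s)).
Proof.
move=> mpsi Hoo.
(* As g0 >= 0, taking parts of [H] amounts to taking parts of [psi]. *)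
have Hp s y : maxe (H s y) 0 = psi^\+ (hat y, s) * (g0 y)%:E.
  by rewrite /H funeposE [RHS]muleC maxe_pMr ?lee_fin// mule0 muleC.
have Hn s y : maxe (- H s y) 0 = psi^\- (hat y, s) * (g0 y)%:E.
  by rewrite /H funenegE [RHS]muleC maxe_pMr ?lee_fin// mule0 muleN muleC.
have mH : measurable_fun setT (fun p : X * Y => H p.1 p.2).
  apply: emeasurable_funM; last by do 2 apply: measurableT_comp => //.
  apply: (measurableT_comp mpsi); apply: measurable_fun_pair => //.
  exact: measurableT_comp.
have mpsip : measurable_fun setT psi^\+ by exact: measurable_funepos.
have mpsin : measurable_fun setT psi^\- by exact: measurable_funeneg.
pose Ip := \int[l]_s \int[n]_y maxe (H s y) 0.
pose In := \int[l]_s \int[n]_y maxe (- H s y) 0.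
pose Pp t := \int[l]_s psi^\+ (t, s).
pose Pn t := \int[l]_s psi^\- (t, s).
have Pp0 t : 0 <= Pp t by exact: integral_ge0.
have Pn0 t : 0 <= Pn t by exact: integral_ge0.
have mPp : measurable_fun setT Pp by exact: measurable_fun_fubini_tonelli_F.
have mPn : measurable_fun setT Pn by exact: measurable_fun_fubini_tonelli_F.
have IpE : Ip = \int[l]_(t in Theta) (K t * Pp t).
  rewrite -ge0_sufficient_reduction//.
  by apply: eq_integral => s _; apply: eq_integral => y _; exact: Hp.
have InE : In = \int[l]_(t in Theta) (K t * Pn t).
  rewrite -ge0_sufficient_reduction//.
  by apply: eq_integral => s _; apply: eq_integral => y _; exact: Hn.
transitivity (Ip - In).
  (* Splitting the inner integral into parts is its definition; only the outer subtraction calls on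
     finiteness. *)
  rewrite /Ip /In -ge0_integralB//.
  - apply: eq_integral => s _; rewrite [LHS]integralE.
    by congr (_ - _); apply: eq_integral => y _; rewrite ?funeposE ?funenegE.
  - apply: (measurable_fun_fubini_tonelli_F (fun p => maxe (H p.1 p.2) 0)).
      exact: measurable_maxe.
    by move=> p; rewrite le_max lexx orbT.
  - apply: (measurable_fun_fubini_tonelli_F (fun p => maxe (- H p.1 p.2) 0)).
      by apply: measurable_maxe => //; exact: measurableT_comp.
    by move=> p; rewrite le_max lexx orbT.
  - by move=> s _; apply: integral_ge0 => y _; rewrite le_max lexx orbT.
  - by move=> s _; apply: integral_ge0 => y _; rewrite le_max lexx orbT.
have mKP : measurable_fun Theta (fun t => K t * Pp t).
  by apply: measurable_funTS; exact: emeasurable_funM.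
have mKN : measurable_fun Theta (fun t => K t * Pn t).
  by apply: measurable_funTS; exact: emeasurable_funM.
have KP0 t : Theta t -> 0 <= K t * Pp t by move=> _; rewrite mule_ge0.
have KN0 t : Theta t -> 0 <= K t * Pn t by move=> _; rewrite mule_ge0.
have psiE t : \int[l]_s psi (t, s) = Pp t - Pn t.
  by rewrite integralE; congr (_ - _); apply: eq_integral => s _;
    rewrite ?funeposE ?funenegE.
move: Hoo; rewrite -/Ip -/In IpE InE => KPNoo.
(* The integrands may differ where [K t * Pp t] and [K t * Pn t] are both infinite, which happens
   only on a null set. *)
rewrite -ge0_integralB//; apply: ae_eq_integral => //.
- exact: emeasurable_funB.
- apply: measurable_funTS; apply: emeasurable_funM => //.
  exact: measurable_fun_integral_section.
have KPNfin : {ae l, forall t, Theta t ->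
    (K t * Pp t \is a fin_num) || (K t * Pn t \is a fin_num)}.
  by case: KPNoo => [/(ge0_ae_fin_num _ _ _ _ _ _ mTheta mKP KP0)
      |/(ge0_ae_fin_num _ _ _ _ _ _ mTheta mKN KN0)];
    apply: filterS => t + Tt => /(_ Tt) ->; rewrite ?orbT.
apply: filterS KPNfin => t + Tt => /(_ Tt) fin.
by rewrite psiE; apply/esym/ge0_muleBr.
Qed.

End sufficient_reduction.

(** The abstract reduction is instantiated with psi (t, s) = phi (qh t; s) g1 (t, s) u s. Most of
    the work is to replace data that are measurable only over [Theta] by globally measurable
    ones. *)
Lemma performance_mle_rule (R : realType) (d : measure_display) (D : measurableType d)
    (mu : {sigma_finite_measure set D -> \bar R}) (N o : nat)
    (Theta : set (euclidean R o)) (mTheta : measurable Theta)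
    (C : R -> D -> R)
    (mC : measurable_fun setT (fun p : R * D => C p.1 p.2))
    (f : D -> euclidean R o -> R)
    (mf : measurable_fun ([set: D] `*` Theta)
            (fun p : D * euclidean R o => f p.1 p.2))
    (u : euclidean R o -> R)
    (measu : measurable_fun Theta u) (u0 : forall t, Theta t -> (0 <= u t)%R)
    (hat : N.-tuple D -> euclidean R o) (mhat : measurable_fun setT hat)
    (hatT : forall y, Theta (hat y))
    (g0 : N.-tuple D -> R) (mg0 : measurable_fun setT g0)
    (g1 : euclidean R o -> euclidean R o -> R)
    (mg1 : measurable_fun (Theta `*` Theta)
             (fun p : euclidean R o * euclidean R o => g1 p.1 p.2))
    (suff : sufficient_factorization f Theta hat g0 g1)
    (F : set (euclidean R o * (N - o).-tuple D))
    (chart : euclidean R o * (N - o).-tuple D -> N.-tuple D)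
    (J : euclidean R o * (N - o).-tuple D -> R)
    (repar : reparametrization mu Theta hat F chart J)
    (qh : euclidean R o -> R) (mqh : measurable_fun Theta qh)
    (wd : performance_well_defined mu C f Theta u (qh \o hat)) :
  performance mu C f Theta u (qh \o hat) =
  reduced_objective mu C f Theta u (fibre_weight mu F chart J g0) g1 qh.
Proof.
have [g00 g10 gfac] := suff.
have [mF mchart bij mJ J0 cov] := repar.
have hat_chart t w : Theta t -> F (t, w) -> hat (chart (t, w)) = t.
  by move=> Tt Ftw; have [/(_ w) + _ _] := bij t Tt; apply; rewrite /xsection/= inE.
(* Extensions by zero are measurable everywhere; that of [u] also makes every integrand vanish for
   parameters outside [Theta]. *)
pose f' := (fun p : D * euclidean R o => f p.1 p.2) \_ ([set: D] `*` Theta).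
pose g1' :=
  (fun p : euclidean R o * euclidean R o => g1 p.1 p.2) \_ (Theta `*` Theta).
pose u' := u \_ Theta.
pose q' := qh \_ Theta.
have mf' : measurable_fun setT f'.
  by apply: (measurable_restrictT _ _).1 => //; exact: measurableX.
have mg1' : measurable_fun setT g1'.
  by apply: (measurable_restrictT _ _).1 => //; exact: measurableX.
have mu' : measurable_fun setT u'.
  exact: (measurable_restrictT _ _).1.
have mq' : measurable_fun setT q'.
  exact: (measurable_restrictT _ _).1.
have f'E x s : Theta s -> f' (x, s) = f x s.
  by move=> Ts; rewrite /f' patchE mem_set.
have g1'E t s : Theta t -> Theta s -> g1' (t, s) = g1 t s.
  by move=> Tt Ts; rewrite /g1' patchE mem_set.
have u'E s : Theta s -> u' s = u s by move=> Ts; rewrite /u' patchE mem_set.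
have u'0 s : ~ Theta s -> u' s = 0%R.
  by move=> Ts; rewrite /u' patchE memNset.
have q'E t : Theta t -> q' t = qh t by move=> Tt; rewrite /q' patchE mem_set.
have g1'_ge0 p : (0 <= g1' p)%R.
  by rewrite /g1' patchE; case: ifPn => // /set_mem[]; exact: g10.
have u'_ge0 s : (0 <= u' s)%R.
  by rewrite /u' patchE; case: ifPn => // /set_mem; exact: u0.
pose w p := (g1' p * u' p.2)%R.
have w_ge0 p : (0 <= w p)%R by rewrite /w mulr_ge0.
have mw : measurable_fun setT w.
  by apply: measurable_funM => //; exact: measurableT_comp.
pose c (p : euclidean R o * euclidean R o * D) :=
  (C (q' p.1.1) p.2 * f' (p.2, p.1.2))%R.
have mc : measurable_fun setT c.
  apply: measurable_funM.
    apply: (measurableT_comp mC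
      (g := fun p : euclidean R o * euclidean R o * D => (q' p.1.1, p.2))).
    by apply: measurable_fun_pair => //; do 2 apply: measurableT_comp => //.
  apply: measurableT_comp => //; apply: measurable_fun_pair => //.
  exact: measurableT_comp.
pose psi p := (\int[mu]_x (c (p, x))%:E) * (w p)%:E.
have mpsi : measurable_fun setT psi.
  apply: emeasurable_funM; last exact/measurable_EFinP.
  by apply: (measurable_fun_integral_section _ _ _ _ _ mu (EFin \o c));
    exact/measurable_EFinP.
(* The integrand of the performance after factorization of the joint density, extended by zero in
   the parameter. *)
pose h (p : euclidean R o * N.-tuple D * D) :=
  (c (hat p.1.2, p.1.1, p.2) * (w (hat p.1.2, p.1.1) * g0 p.1.2))%:E.
have mhatp : measurable_fun setT
    (fun p : euclidean R o * N.-tuple D => (hat p.2, p.1)).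
  by apply: measurable_fun_pair => //; exact: measurableT_comp.
have mh : measurable_fun setT h.
  apply/measurable_EFinP; apply: measurable_funM.
    apply: (measurableT_comp mc); apply: measurable_fun_pair => //.
    exact: (measurableT_comp mhatp).
  apply: measurable_funM; last by do 2 apply: measurableT_comp => //.
  by apply: (measurableT_comp mw); exact: (measurableT_comp mhatp).
have hE s y x : Theta s ->
    (performance_integrand C f u (qh \o hat) s y x)%:E = h (s, y, x).
  move=> Ts; rewrite /h /c /w /= f'E// g1'E// u'E// q'E//.
  by rewrite /performance_integrand/= gfac// -!mulrA (mulrCA (g0 y)) (mulrC (g0 y)).
have h0 s y x : ~ Theta s -> h (s, y, x) = 0.
  by move=> Ts; rewrite /h /w /= u'0// !(mulr0, mul0r).
pose H (p : euclidean R o * N.-tuple D) := psi (hat p.2, p.1) * (g0 p.2)%:E.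
(* The factor w g0 is finite, non-negative and constant in x, so it leaves the integral even where
   the expected cost has the form oo - oo. *)
have HE p : H p = \int[mu]_x h (p, x).
  rewrite /H /psi -muleA -EFinM -ge0_integralZr_EFin ?mulr_ge0//.
  apply/measurable_EFinP; apply: (measurableT_comp mc).
  exact: measurable_fun_pair.
have mH : measurable_fun setT H.
  apply: emeasurable_funM; first exact: (measurableT_comp mpsi).
  by do 2 apply: measurableT_comp => //.
have Hoo : \int[lebesgue_euclidean o]_s \int[power_measure mu N]_y
     maxe (H (s, y)) 0 < +oo \/
   \int[lebesgue_euclidean o]_s \int[power_measure mu N]_y
     maxe (- H (s, y)) 0 < +oo.
  have hmk : (fun p => (performance_integrand C f u (qh \o hat) p.1.1 p.1.2 p.2)%:E)
      \_ ((Theta `*` [set: N.-tuple D]) `*` [set: D]) = h.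
    apply/funext => -[[s y] x]; rewrite patchE; case: ifPn => [|/negP].
      by rewrite inE => -[[Ts _] _]; rewrite hE.
    by rewrite inE => Ts; rewrite h0// => Ts'; apply: Ts.
  move: wd; rewrite /performance_well_defined /integral_well_defined.
  rewrite !(integral_mkcond (_ `*` _)) -funepos_restrict -funeneg_restrict hmk.
  case=> hoo; [left|right].
  - apply: (ge0_iterated_integral_lty _ _ _ _ _ _ _ _ _ mu
      (fun p => maxe (H p) 0) h^\+) => //.
    + exact: measurable_maxe.
    + by move=> p; rewrite le_max lexx orbT.
    + exact: measurable_funepos.
    + by move=> p; rewrite HE; under [leRHS]eq_integral do rewrite funeposE;
       exact: funepos_integral_le.
  - apply: (ge0_iterated_integral_lty _ _ _ _ _ _ _ _ _ mu
      (fun p => maxe (- H p) 0) h^\-) => //.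
    + by apply: measurable_maxe => //; exact: measurableT_comp.
    + by move=> p; rewrite le_max lexx orbT.
    + exact: measurable_funeneg.
    + by move=> p; rewrite HE; under [leRHS]eq_integral do rewrite funenegE;
       exact: funeneg_integral_le.
(* The restriction to [Theta] is dropped here, since [h] vanishes off it; it is restored in [beth]
   below for the same reason. *)
transitivity (\int[lebesgue_euclidean o]_s \int[power_measure mu N]_y H (s, y)).
  rewrite /performance integral_mkcond; apply: eq_integral => s _.
  rewrite patchE; case: ifPn => [/set_mem Ts|/negP Ts].
    apply: eq_integral => y _; rewrite HE; apply: eq_integral => x _.
    exact: hE.
  rewrite integral0_eq// => y _; rewrite HE integral0_eq// => x _.
  by apply: h0 => Ts'; apply: Ts; rewrite inE.
apply: etrans.
  exact: (sufficient_reduction (lebesgue_euclidean o) (power_measure mu N)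
    (power_measure mu (N - o)) Theta hat F chart J g0 mTheta mhat mF mchart mJ
    mg0 J0 g00 hat_chart cov psi mpsi Hoo).
apply: eq_integral => t /set_mem Tt; congr (_ * _).
rewrite /beth [RHS]integral_mkcond; apply: eq_integral => s _.
rewrite patchE; case: ifPn => [/set_mem Ts|/negP Ts]; last first.
  by rewrite /psi /w /= u'0 ?mulr0 ?mule0// => Ts'; apply: Ts; rewrite inE.
rewrite /psi /w /= g1'E// u'E//; congr (_ * _).
by apply: eq_integral => x _; rewrite /c /= q'E// f'E.
Qed.

Local Close Scope ereal_scope.

Theorem theorem1 (R : realType) (d : measure_display) (D : measurableType d)
    (mu : {sigma_finite_measure set D -> \bar R}) (N o : nat) (oN : (o <= N)%N)
    (Q : set R) (Theta : set (euclidean R o)) (mTheta : measurable Theta)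
    (C : R -> D -> R)
    (mC : measurable_fun setT (fun p : R * D => C p.1 p.2))
    (f : D -> euclidean R o -> R)
    (mf : measurable_fun ([set: D] `*` Theta)
            (fun p : D * euclidean R o => f p.1 p.2))
    (df : forall theta, Theta theta -> is_density mu setT (fun x => f x theta))
    (u : euclidean R o -> R)
    (du : is_density (lebesgue_euclidean o) Theta u)
    (hat : N.-tuple D -> euclidean R o) (mhat : measurable_fun setT hat)
    (mle : is_mle f Theta hat)
    (g0 : N.-tuple D -> R) (mg0 : measurable_fun setT g0)
    (g1 : euclidean R o -> euclidean R o -> R)
    (mg1 : measurable_fun (Theta `*` Theta)
             (fun p : euclidean R o * euclidean R o => g1 p.1 p.2))
    (suff : sufficient_factorization f Theta hat g0 g1)
    (F : set (euclidean R o * (N - o).-tuple D))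
    (chart : euclidean R o * (N - o).-tuple D -> N.-tuple D)
    (J : euclidean R o * (N - o).-tuple D -> R)
    (repar : reparametrization mu Theta hat F chart J)
    (wd : forall q, mle_sufficient Q Theta hat q ->
            performance_well_defined mu C f Theta u q) :
  let Psi := performance mu C f Theta u in
  let K := fibre_weight mu F chart J g0 in
  let Red := reduced_objective mu C f Theta u K g1 in
  (forall qh, mle_rule Q Theta hat qh -> Psi (qh \o hat) = Red qh) /\
  ereal_inf [set Psi q | q in mle_sufficient Q Theta hat] =
  ereal_inf [set Red qh | qh in mle_rule Q Theta hat].
Proof.
move=> Psi K Red.
have PsiRed qh : mle_rule Q Theta hat qh -> Psi (qh \o hat) = Red qh.
  move=> rqh; have [measu u0 _] := du.
  apply: (performance_mle_rule _ _ _ _ _ _ _ mTheta) => //.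
    by move=> y; have [] := mle y.
    by have [] := rqh.
  by apply: wd; exists qh.
(* Both infima run over the same values. A solution does not determine its rule off the range of
   [hat], but [PsiRed] gives every rule inducing it the same reduced objective. *)
split=> //; congr ereal_inf; apply/seteqP; split.
- by move=> _ [_ [qh rqh <-] <-]; exists qh => //; rewrite PsiRed.
- by move=> _ [qh rqh <-]; exists (qh \o hat); [exists qh|exact: PsiRed].
Qed.
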